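(* For regular dessins the invariant ${\rm tot}$ is determined by the monodromy group as an abstract group: if $\mathcal D$ and $\mathcal E$ are regular dessins whose monodromy groups are isomorphic as abstract groups, then ${\rm tot}(\mathcal D)={\rm tot}(\mathcal E)$.
   Context: A dessin (d'enfant) $\mathcal D$ is a connected finite bipartite graph, with vertices coloured white or black so that each edge joins a white to a black vertex, embedded in a closed oriented surface so that the components of the complement (the faces) are open discs. Let $\sigma_0$ and $\sigma_1$ be the permutations of the $n$ edges given by the cyclic order of edges around white and black vertices respectively, and $\sigma_\infty=(\sigma_0\sigma_1)^{-1}$; the cycles of $\sigma_0,\sigma_1,\sigma_\infty$ correspond to white vertices, black vertices and faces. Up to equivalence, dessins correspond to pairs $(\sigma_0,\sigma_1)$ generating a transitive subgroup of $S_n$, up to simultaneous conjugacy. The monodromy group is $M=\langle\sigma_0,\sigma_1\rangle$. A dessin is regular if the stabiliser in $M$ of an edge is trivial. A dessin is Z-orientable if its faces can be labelled $+$ or $-$ so that each edge is incident with two faces having different labels (so a dessin having an edge with the same face on both sides is not Z-orientable). Let $\mathcal D'$ and $\mathcal D''$ be the dessins corresponding to the triples $(\sigma_1,\sigma_\infty,\sigma_0)$ and $(\sigma_\infty,\sigma_0,\sigma_1)$ in place of $(\sigma_0,\sigma_1,\sigma_\infty)$. Then ${\rm tot}(\mathcal D)$ is the number of Z-orientable dessins in the triple $\mathcal D,\mathcal D',\mathcal D''$ (counted as a triple). *)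

(* Defs.v *)
From mathcomp Require Import all_boot all_fingroup.

Set Implicit Arguments.
Unset Strict Implicit.
Unset Printing Implicit Defensive.

Import GroupScope.

(* A dessin with edge set E, up to equivalence: sigma0 and sigma1 rotate the
   edges anticlockwise around their white and black vertices; the embedded
   graph is connected iff they generate a transitive group, and its faces are
   then discs.  The transitivity predicate also forces E to be nonempty. *)
Record dessin (E : finType) := Dessin {
  sigma0 : {perm E};
  sigma1 : {perm E};
  dessin_trans : [transitive <<[set sigma0; sigma1]>>, on [set: E] | 'P]
}.

Section Dessin.
Variables (E : finType) (D : dessin E).

(* Permutations compose from left to right: (s * t) e = t (s e). *)
Definition sigmaoo : {perm E} := (sigma0 D * sigma1 D)^-1.

Definition monodromy : {group {perm E}} := <<[set sigma0 D; sigma1 D]>>%G.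

Definition regular : Prop := forall e : E, 'C_monodromy[e | 'P] = 1.

Definition face := {f : {set E} | f \in porbits sigmaoo}.

Fact face_ofP (e : E) : porbit sigmaoo e \in porbits sigmaoo.
Proof. exact: imset_f. Qed.

Definition face_of (e : E) : face := Sub (porbit sigmaoo e) (face_ofP e).

(* Look along e from its white to its black end.  Turning anticlockwise around
   the white end, the face on the left of e lies between e and sigma0 e; at the
   black end of sigma0 e it lies between sigma0 e and sigma1 (sigma0 e), which
   again has it on its left.  So a cycle of sigmaoo consists of the edges having
   a given face on their left.  Turning anticlockwise around the black end of e,
   the face on the right of e lies between e and sigma1 e, and so is the face on
   the left of sigma1 e. *)
Definition left_face (e : E) : face := face_of e.
Definition right_face (e : E) : face := face_of (sigma1 D e).

Definition Z_orientable : bool :=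
  [exists lab : {ffun face -> bool},
     [forall e, lab (left_face e) != lab (right_face e)]].

Lemma sigma1oo_gen :
  <<[set sigma1 D; sigmaoo]>> = <<[set sigma0 D; sigma1 D]>>.
Proof.
have s0E : sigma0 D = (sigma1 D * sigmaoo)^-1 by rewrite invMg invgK mulgK.
apply/eqP; rewrite eqEsubset !gen_subG !subUset !sub1set; apply/andP; split.
  by rewrite groupV groupM ?mem_gen ?set21 ?set22.
by rewrite {1}s0E groupV groupM ?mem_gen ?set21 ?set22.
Qed.

Lemma sigmaoo0_gen :
  <<[set sigmaoo; sigma0 D]>> = <<[set sigma0 D; sigma1 D]>>.
Proof.
have s1E : sigma1 D = (sigmaoo * sigma0 D)^-1 by rewrite invMg invgK mulKg.
apply/eqP; rewrite eqEsubset !gen_subG !subUset !sub1set; apply/andP; split.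
  by rewrite groupV groupM ?mem_gen ?set21 ?set22.
by rewrite {1}s1E groupV groupM ?mem_gen ?set21 ?set22.
Qed.

Fact sigma1oo_trans :
  [transitive <<[set sigma1 D; sigmaoo]>>, on [set: E] | 'P].
Proof. by rewrite sigma1oo_gen; apply: dessin_trans. Qed.

Fact sigmaoo0_trans :
  [transitive <<[set sigmaoo; sigma0 D]>>, on [set: E] | 'P].
Proof. by rewrite sigmaoo0_gen; apply: dessin_trans. Qed.

Definition dessin' : dessin E := Dessin sigma1oo_trans.
Definition dessin'' : dessin E := Dessin sigmaoo0_trans.

End Dessin.

Lemma sigmaoo_dessin' (E : finType) (D : dessin E) :
  sigmaoo (dessin' D) = sigma0 D.
Proof. by rewrite {1}/sigmaoo /= invMg invgK mulgK. Qed.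

Lemma sigmaoo_dessin'' (E : finType) (D : dessin E) :
  sigmaoo (dessin'' D) = sigma1 D.
Proof. by rewrite {1}/sigmaoo /= invMg invgK mulKg. Qed.

Definition tot (E : finType) (D : dessin E) : nat :=
  (Z_orientable D + Z_orientable (dessin' D) + Z_orientable (dessin'' D))%N.

(* Main.v *)
Require Import Defs.
From mathcomp Require Import all_boot all_fingroup.

Set Implicit Arguments.
Unset Strict Implicit.
Unset Printing Implicit Defensive.

Import GroupScope.

(** For a regular dessin, [tot] counts the subgroups of index 2 of the monodromy
    group M.  A face labelling that changes sign along every edge is reversed by
    sigma0 and sigma1, so its stabiliser in M is a subgroup of index 2 containing
    neither; conversely, when M acts freely, such a subgroup H yields a labelling
    constant on H-orbits.  A subgroup of index 2 is determined by which of sigma0,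
    sigma1 it contains, and the three possibilities (neither, only sigma0, only
    sigma1) account for the dessins D, D' and D''. *)

Section IndexTwo.
Variable gT : finGroupType.
Implicit Types G H K : {group gT}.

Definition index2_subgroups G : {set {group gT}} :=
  [set H : {group gT} | (H \subset G) && (#|G : H| == 2)].

(** For [y] outside [H], the coset [H :* y^-1] avoids [H] and fills half of [G], so it is the whole
    complement; thus membership in [H] behaves as a character of [G] with values in Z/2. *)
Lemma index2_memM G H : H \in index2_subgroups G ->
  {in G &, forall x y, (x * y \in H) = ((x \in H) == (y \in H))}.
Proof.
rewrite inE => /andP[sHG /eqP iHG] x y Gx Gy.
have [Hx|nHx] := boolP (x \in H); first by rewrite groupMl.
have [Hy|nHy] := boolP (y \in H); first by rewrite groupMr ?(negPf nHx).
rewrite eqxx.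
suff defH : H :* y^-1 = G :\: H by rewrite -[y]invgK -mem_rcoset defH inE nHx.
apply/eqP; rewrite eqEcard card_rcoset cardsD (setIidPr sHG) -(Lagrange sHG) iHG.
rewrite muln2 -addnn addnK leqnn andbT; apply/subsetP=> _ /rcosetP[h Hh ->].
by rewrite inE groupMl // groupV nHy groupM ?groupV // (subsetP sHG).
Qed.

(** The elements of [G] on which two Z/2-valued characters agree form a subgroup, so agreement on
    generators spreads to [G]. *)
Lemma index2_inj (A : {set gT}) G H K : G :=: <<A>> ->
  H \in index2_subgroups G -> K \in index2_subgroups G ->
  {in A, H =i K} -> H = K.
Proof.
move=> defG iH iK eqA.
have gB : group_set [set g in G | (g \in H) == (g \in K)].
  apply/group_setP; split=> [|x y]; first by rewrite inE !group1.
  rewrite !inE => /andP[Gx /eqP Ex] /andP[Gy /eqP Ey].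
  by rewrite groupM // (index2_memM iH) // (index2_memM iK) // Ex Ey eqxx.
have sGB : G \subset Group gB.
  rewrite {1}defG gen_subG; apply/subsetP=> x Ax; rewrite inE eqA // eqxx andbT.
  by rewrite defG mem_gen.
move: iH iK; rewrite !inE => /andP[sHG _] /andP[sKG _].
apply/val_inj/setP=> x /=; have [Gx|nGx] := boolP (x \in G).
  by have := subsetP sGB x Gx; rewrite inE => /andP[_ /eqP].
by rewrite (contraNF (subsetP sHG x)) // (contraNF (subsetP sKG x)).
Qed.

(** The kernel of [chi] has index 2 because its complement in [G] is its right coset by [x]. *)
Lemma index2_ker G (chi : gT -> bool) x :
    {in G &, {morph chi : g h / g * h >-> g (+) h}} -> x \in G -> chi x ->
  exists2 H, H \in index2_subgroups G & {in G, forall g, (g \in H) = ~~ chi g}.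
Proof.
move=> chiM Gx chix.
have chi1 : chi 1 = false.
  by have := chiM 1 1 (group1 G) (group1 G); rewrite mulg1 addbb.
have chiV g : g \in G -> chi g^-1 = chi g.
  move=> Gg; apply/eqP; rewrite -negb_add -chiM ?groupV //.
  by rewrite mulVg chi1.
have gH : group_set [set g in G | ~~ chi g].
  apply/group_setP; split=> [|g h]; first by rewrite inE group1 chi1.
  rewrite !inE => /andP[Gg cg] /andP[Gh ch].
  by rewrite groupM // chiM // (negPf cg) (negPf ch).
have sHG : Group gH \subset G by apply/subsetP=> g; rewrite inE => /andP[].
exists (Group gH) => [|g Gg]; last by rewrite inE Gg.
rewrite inE sHG /= -(eqn_pmul2l (cardG_gt0 (Group gH))) Lagrange //.
rewrite -(cardsID (Group gH) G) (setIidPr sHG) muln2 -addnn eqn_add2l.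
rewrite -(card_rcoset (Group gH) x); apply/eqP/eq_card => g.
rewrite mem_rcoset !inE; have [Gg|nGg] := boolP (g \in G).
  by rewrite groupM ?groupV // chiM ?groupV // chiV // chix addbT andbT.
by rewrite groupMr ?groupV // (negPf nGg).
Qed.

End IndexTwo.

Lemma leq_card_index2_subgroups (aT rT : finGroupType) (G : {group aT})
    (K : {group rT}) :
  G \isog K -> #|index2_subgroups G| <= #|index2_subgroups K|.
Proof.
case/isogP=> f injf defK.
have injF : {in index2_subgroups G &, injective (fun H : {group aT} => f @* H)%G}.
  move=> H1 H2; rewrite !inE => /andP[sH1 _] /andP[sH2 _] /(congr1 val) /= eqf.
  exact/val_inj/(injm_morphim_inj injf sH1 sH2 eqf).
rewrite -(card_in_imset injF); apply/subset_leq_card/subsetP=> _ /imsetP[H + ->].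
rewrite !inE => /andP[sHG iHG].
by rewrite -defK morphimS //= index_injm.
Qed.

Lemma card_index2_subgroups_isog (aT rT : finGroupType) (G : {group aT})
    (K : {group rT}) :
  G \isog K -> #|index2_subgroups G| = #|index2_subgroups K|.
Proof.
move=> isoGK; apply/eqP; rewrite eqn_leq !leq_card_index2_subgroups //.
by rewrite isog_sym.
Qed.

Section Dessin.
Variables (E : finType) (D : dessin E).
Local Notation M := (monodromy D).

Lemma sigma0_monodromy : sigma0 D \in M. Proof. by rewrite mem_gen ?set21. Qed.
Lemma sigma1_monodromy : sigma1 D \in M. Proof. by rewrite mem_gen ?set22. Qed.

Lemma sigmaoo_index2 (H : {group {perm E}}) : H \in index2_subgroups M ->
  (sigmaoo D \in H) = ((sigma0 D \in H) == (sigma1 D \in H)).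
Proof.
move=> iH.
by rewrite groupV (index2_memM iH) ?sigma0_monodromy ?sigma1_monodromy.
Qed.

Lemma dessin_base : exists e0 : E, forall e, exists2 g, g \in M & e = g e0.
Proof.
have /imsetP[e0 _ defE] := dessin_trans D.
by exists e0 => e; have := in_setT e; rewrite defE => /imsetP[g Mg ->]; exists g.
Qed.

(** The quotient [g * h^-1] fixes [e0], hence is trivial by regularity. *)
Lemma monodromy_free e0 g h :
  regular D -> g \in M -> h \in M -> g e0 = h e0 -> g = h.
Proof.
move=> regD Mg Mh eq_gh; apply/eqP; rewrite eq_mulgV1 -in_set1.
rewrite -[[set 1]](regD e0) inE groupM ?groupV //=; apply/astab1P.
by rewrite /= apermE permM eq_gh permK.
Qed.

Lemma sigmaoo_sigma0 e : sigmaoo D (sigma1 D (sigma0 D e)) = e.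
Proof. by rewrite -[sigma1 D _]permM permK. Qed.

Lemma Z_orientable_index2 : Z_orientable D ->
  exists2 H, H \in index2_subgroups M &
    (sigma0 D \notin H) && (sigma1 D \notin H).
Proof.
case/existsP=> lab /forallP labP; have [e0 _] := dessin_base.
pose l e := lab (left_face D e).
(* The right face of [e] is the left face of [sigma1 D e], so [sigma1] flips [l]; [sigmaoo] keeps
   the left face, whence [sigma0] flips [l] as well. *)
have l1 e : l (sigma1 D e) = ~~ l e.
  by apply/esym/addbP; rewrite -negb_eqb; apply: labP.
have loo e : l (sigmaoo D e) = l e.
  congr (lab _); apply: val_inj => /=; apply/eqP.
  by rewrite eq_porbit_mem -{1}[sigmaoo D]expg1 mem_porbit.
have l0 e : l (sigma0 D e) = ~~ l e.
  by rewrite -{2}[e]sigmaoo_sigma0 loo l1 negbK.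
pose chi (g : {perm E}) := l (g e0) (+) l e0.
(* The permutations that change the label at every edge as they do at [e0] form a group; it contains
   both generators, hence [M], and on [M] the sign change is multiplicative. *)
have gB : group_set [set g : {perm E} | [forall e, l (g e) == chi g (+) l e]].
  apply/group_setP; split=> [|g h].
    by rewrite inE; apply/forallP=> e; rewrite /chi !perm1 addbb.
  rewrite !inE => /forallP lg /forallP lh; apply/forallP=> e.
  rewrite /chi !permM !(eqP (lh _)) !(eqP (lg _)).
  by case: (chi g) (chi h) (l e) (l e0) => [] [] [] [].
have sMB : M \subset Group gB.
  rewrite gen_subG subUset !sub1set !inE.
  by apply/andP; split; apply/forallP=> e; rewrite /chi ?l0 ?l1 addNb addbb.
have chiM : {in M &, {morph chi : g h / g * h >-> g (+) h}}.
  move=> g h _ Mh; have := subsetP sMB h Mh; rewrite inE => /forallP lh.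
  by rewrite {1}/chi permM (eqP (lh _)) addbC /chi; case: (l _) (l _) (l _) => [] [] [].
have chi0 : chi (sigma0 D) by rewrite /chi l0 addNb addbb.
have chi1 : chi (sigma1 D) by rewrite /chi l1 addNb addbb.
have [H iH HP] := index2_ker chiM sigma0_monodromy chi0.
by exists H; rewrite // !HP ?sigma0_monodromy ?sigma1_monodromy // chi0 chi1.
Qed.

Lemma index2_Z_orientable (H : {group {perm E}}) : regular D ->
  H \in index2_subgroups M -> sigma0 D \notin H -> sigma1 D \notin H ->
  Z_orientable D.
Proof.
move=> regD iH nH0 nH1; have [e0 e0P] := dessin_base.
have Hoo : sigmaoo D \in H by rewrite sigmaoo_index2 // (negPf nH0) (negPf nH1).
have sHM : H \subset M by move: iH; rewrite inE => /andP[].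
pose lab := [ffun f : face D => [exists g in H, g e0 \in val f]].
(* The label does not depend on the edge chosen on the face: by freeness, if [h e0] lies on the face
   of [g e0] then [h] is [g] times a power of [sigmaoo D], which belongs to [H]. *)
have labP g : g \in M -> lab (face_of D (g e0)) = (g \in H).
  move=> Mg; rewrite ffunE; apply/exists_inP/idP=> [[h Hh]|Hg]; last first.
    by exists g => //=; rewrite porbit_id.
  case/porbitP=> i; rewrite -permM => /monodromy_free eq_h.
  have Hi : sigmaoo D ^+ i \in H by rewrite groupX.
  have defh : h = g * sigmaoo D ^+ i.
    by apply: eq_h; rewrite // ?groupM // (subsetP sHM).
  by move: Hh; rewrite defh groupMr.
apply/existsP; exists lab; apply/forallP=> e; have [g Mg ->] := e0P e.
have Mg1 : g * sigma1 D \in M by rewrite groupM ?sigma1_monodromy.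
rewrite /right_face -permM !labP // (index2_memM iH) ?sigma1_monodromy //.
rewrite (negPf nH1).
by case: (g \in H).
Qed.

Lemma card_index2_Z_orientable : regular D ->
  #|[set H in index2_subgroups M | (sigma0 D \notin H) && (sigma1 D \notin H)]|
    = Z_orientable D.
Proof.
move=> regD; have [ZD|nZD] := boolP (Z_orientable D).
  have [H iH /andP[nH0 nH1]] := Z_orientable_index2 ZD.
  apply/eqP/cards1P; exists H; apply/setP=> K; rewrite in_set1 inE.
  apply/andP/eqP=> [[iK /andP[nK0 nK1]]|->]; last by rewrite nH0.
  (* Both subgroups miss both generators, so they coincide. *)
  apply: (index2_inj _ iK iH) => // g; rewrite !inE.
  by case/orP=> /eqP->; rewrite ?(negPf nH0) ?(negPf nH1); apply: negPf.
apply/eqP; rewrite cards_eq0; apply/set0Pn=> -[H]; rewrite inE.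
by case/and3P=> iH nH0 nH1; rewrite (index2_Z_orientable regD iH) in nZD.
Qed.

End Dessin.

Lemma monodromy_dessin' (E : finType) (D : dessin E) :
  monodromy (dessin' D) = monodromy D.
Proof. exact/val_inj/sigma1oo_gen. Qed.

Lemma monodromy_dessin'' (E : finType) (D : dessin E) :
  monodromy (dessin'' D) = monodromy D.
Proof. exact/val_inj/sigmaoo0_gen. Qed.

Lemma tot_index2 (E : finType) (D : dessin E) :
  regular D -> tot D = #|index2_subgroups (monodromy D)|.
Proof.
move=> regD; set I := index2_subgroups _.
have regD' : regular (dessin' D) by move=> e; rewrite monodromy_dessin'.
have regD'' : regular (dessin'' D) by move=> e; rewrite monodromy_dessin''.
rewrite /tot -!card_index2_Z_orientable // monodromy_dessin' monodromy_dessin''.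
(* Both sides become sums over [I]; it remains to see that each [H] misses exactly one of the pairs
   ([sigma0], [sigma1]), ([sigma1], [sigmaoo]), ([sigmaoo], [sigma0]). *)
rewrite -/I /= -(sum1_card (mem I)) -!sum1dep_card !big_mkcondr -!big_split /=.
apply: eq_bigr => H iH; rewrite sigmaoo_index2 //.
have [H0|_] := boolP (sigma0 D \in H);
  have [H1|_] := boolP (sigma1 D \in H) => //.
(* Containing both generators would make [H] all of [M], against index 2. *)
have : 1 < #|monodromy D : H| by move: iH; rewrite inE => /andP[_ /eqP->].
by rewrite indexg_gt1 gen_subG subUset !sub1set H0 H1.
Qed.

Theorem theorem3 (E F : finType) (D : dessin E) (D2 : dessin F) :
  regular D -> regular D2 ->
  monodromy D \isog monodromy D2 ->
  tot D = tot D2.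
Proof.
move=> regD regD2 isoD.
by rewrite !tot_index2 //; apply: card_index2_subgroups_isog.
Qed.
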